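(* Let $P=(X,\prec)$ be a finite poset with $n=|X|$ elements and let $x,y\in X$ with $x\prec y$. Let $F(k)$ be the number of linear extensions $L$ of $P$ with $L(y)-L(x)=k$. Then $F(k)>0$ if and only if $$h(x,y)<k<n-f(x)-g(y).$$
   Context: A linear extension of $P$ is a bijection $L:X\to\{1,\dots,n\}$ with $L(u)<L(v)$ whenever $u\prec v$. For $u\in X$, $f(u):=|\{v\in X:v\prec u\}|$, $g(u):=|\{v\in X:v\succ u\}|$, and for $u,w\in X$, $h(u,w):=|\{v\in X:u\prec v\prec w\}|$. *)

(* Defs.v *)
From mathcomp Require Import all_boot all_order all_algebra.
Set Implicit Arguments.
Unset Strict Implicit.
Unset Printing Implicit Defensive.
Import Order.TTheory GRing.Theory Num.Theory.

Section LinearExtensions.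
Variables (d : Order.disp_t) (X : finPOrderType d).
Local Open Scope order_scope.

Definition f (u : X) : nat := #|[set v : X | v < u]|.
Definition g (u : X) : nat := #|[set v : X | v > u]|.
Definition h (u w : X) : nat := #|[set v : X | u < v < w]|.

(* The label set {1, ..., n} is encoded as 'I_n by the shift i |-> i + 1:
   L u : 'I_n stands for the 1-based label [label L u]. *)
Definition label (L : {ffun X -> 'I_#|X|}) (u : X) : nat := (L u).+1.

Definition linear_extension (L : {ffun X -> 'I_#|X|}) : bool :=
  [&& injectiveb L,
      [forall i : 'I_#|X|, exists u : X, L u == i]
    & [forall u : X, forall v : X, (u < v) ==> (label L u < label L v)%N]].

Definition F (x y : X) (k : int) : nat :=
  #|[set L : {ffun X -> 'I_#|X|} | linear_extension L
       & ((label L y)%:Z - (label L x)%:Z == k)%R]|.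

End LinearExtensions.

(* Main.v *)
Require Import Defs.
From mathcomp Require Import all_boot all_order all_algebra.
From mathcomp Require Import zify.
Import Order.TTheory GRing.Theory Num.Theory.
Set Implicit Arguments.
Unset Strict Implicit.
Unset Printing Implicit Defensive.

(** The elements placed before [x] and the elements placed before [y] form down
    sets [A] and [E] with [x] in [E], not in [A], all predecessors of [x] in [A],
    all predecessors of [y] in [E], and [y] not in [E].  Conversely every such
    pair with [A] included in [E] comes from a linear extension, for which
    [L y - L x = #|E| - #|A|].  The smallest difference [h x y + 1] is attained
    with [E] the strict predecessors of [y] and [A] those of them that are not
    above [x]; the largest one with [A] the strict predecessors of [x] and [E]
    the elements not above [y].  One moves from the first pair to the second by
    shrinking [A] and then enlarging [E] one element at a time. *)

Section Realization.
Variables (d : Order.disp_t) (X : finPOrderType d).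
Implicit Types (u v x y : X) (S T A E : {set X}) (L : {ffun X -> 'I_#|X|}).

Definition downset S : Prop :=
  forall u v, (u < v)%O -> v \in S -> u \in S.

Lemma f_lt u v : (u < v)%O -> (f u < f v)%N.
Proof.
move=> uv; apply: proper_card; apply/properP; split.
  by apply/subsetP=> w; rewrite !inE => /lt_trans; apply.
by exists u; rewrite !inE ?ltxx.
Qed.

Lemma f_le_card u : (f u <= #|X|)%N.
Proof. exact: max_card. Qed.

Lemma downset_interpolation S T m :
  downset S -> downset T -> S \subset T -> (#|S| <= m <= #|T|)%N ->
  exists E, [/\ downset E, S \subset E, E \subset T & #|E| = m].
Proof.
move=> dS dT sST; elim: m => [|m IHm] /andP[leS leT].
  by exists S; split=> //; apply/eqP; rewrite -leqn0.
case: (ltngtP #|S| m.+1) leS => // [ltS _|<- _]; last by exists S.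
have [|E [dE sSE sET cE]] := IHm; first by rewrite -ltnS ltS ltnW.
have : E \proper T by rewrite properEcard sET cE.
case/properP=> _ [w0 w0T w0E].
(* Since [f] is strictly increasing, a [w] minimizing [f] on [T :\: E] has all its predecessors in
   [E]: they lie in [T] and have smaller [f]. Hence [w |: E] is again a down set. *)
case: (@arg_minnP _ w0 (mem (T :\: E)) (@f d X)); first by rewrite inE /= in_setD w0E.
move=> w; rewrite /= in_setD => /andP[wE wT] minw.
exists (w |: E); split.
- move=> u v uv; rewrite !inE => /orP[/eqP vw|vE]; last first.
    by rewrite (dE u v) ?orbT.
  rewrite {v}vw in uv *; case uE: (u \in E); first by rewrite orbT.
  have := minw u; rewrite !inE uE (dT u w) // => /(_ isT).
  by rewrite leqNgt f_lt.
- exact: subset_trans sSE (subsetUr _ _).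
- by rewrite subUset sub1set wT.
- by rewrite cardsU1 wE cE.
Qed.

Lemma linear_extension_lt L u v :
  linear_extension L -> (u < v)%O -> (L u < L v)%N.
Proof. by case/and3P=> _ _ /forallP/(_ u)/forallP/(_ v)/implyP. Qed.

(** [L] is a bijection onto ['I_#|X|], so the elements placed before [u] correspond to the ordinals
    below [L u]. This turns positions into cardinals of sets. *)
Lemma linear_extension_rank L u :
  linear_extension L -> #|[set v | (L v < L u)%N]| = L u.
Proof.
case/and3P=> /injectiveP injL _ _.
have bijL : bijective L by apply: inj_card_bij; rewrite ?card_ord.
rewrite -(card_imset _ injL).
have -> : L @: [set v | (L v < L u)%N] = [set i : 'I_#|X| | (i < L u)%N].
  apply/setP=> i; rewrite inE; apply/imsetP/idP => [[v + ->]|].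
    by rewrite inE.
  by case: bijL => M _ MK lti; exists (M i); rewrite ?inE MK.
rewrite -sum1dep_card -(big_ord_widen #|X| (fun=> 1%N) (ltnW (ltn_ord (L u)))).
by rewrite sum1_card card_ord.
Qed.

(** Sort by [c] and break ties by [enum_rank], which is less than [#|X|], so that [key] orders pairs
    lexicographically. The position of [u] is the number of elements with smaller key. *)
Lemma linear_extension_of_weight (c : X -> nat) :
  {homo c : u v / (u < v)%O >-> (u < v)%N} ->
  exists2 L, linear_extension L & forall u v, (c u < c v)%N -> (L u < L v)%N.
Proof.
move=> c_lt; pose key u := (c u * #|X| + enum_rank u)%N.
have key_lt u v : (c u < c v)%N -> (key u < key v)%N.
  move=> cuv; apply: leq_trans (leq_addr _ _).
  apply: leq_trans (leq_mul cuv (leqnn #|X|)).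
  by rewrite mulSn /key addnC ltn_add2r.
have key_inj : injective key.
  move=> u v euv; case: (ltngtP (c u) (c v)) => [/key_lt|/key_lt|cuv].
  - by rewrite euv ltnn.
  - by rewrite euv ltnn.
  by apply/enum_rank_inj/val_inj; move: euv; rewrite /key cuv => /addnI.
pose below u := [set v | (key v < key u)%N].
have below_lt u v : (key u < key v)%N -> (#|below u| < #|below v|)%N.
  move=> kuv; apply: proper_card; apply/properP; split.
    by apply/subsetP=> w; rewrite !inE => /ltn_trans; apply.
  by exists u; rewrite !inE ?ltnn.
have below_card u : (#|below u| < #|X|)%N.
  rewrite -cardsT; apply: proper_card; apply/properP; split.
    exact: subsetT.
  by exists u; rewrite !inE ?ltnn.
pose L := [ffun u => Ordinal (below_card u)].
have L_lt u v : (key u < key v)%N -> (L u < L v)%N.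
  by rewrite !ffunE; apply: below_lt.
have L_inj : injective L.
  move=> u v euv; apply: key_inj.
  by case: (ltngtP (key u) (key v)) => // /L_lt; rewrite euv ltnn.
exists L; last by move=> u v /key_lt/L_lt.
apply/and3P; split; first exact/injectiveP.
  have [M _ MK] : bijective L by apply: inj_card_bij; rewrite ?card_ord.
  by apply/forallP=> i; apply/existsP; exists (M i); rewrite MK.
apply/forallP=> u; apply/forallP=> v; apply/implyP=> uv.
by rewrite ltnS; apply/L_lt/key_lt/c_lt.
Qed.

Lemma linear_extension_of_downsets x y A E :
  downset A -> downset E -> A \subset E -> x \notin A -> x \in E ->
  y \notin E -> (forall u, (u < x)%O -> u \in A) ->
  (forall u, (u < y)%O -> u \in E) ->
  exists2 L, linear_extension L & (L x = #|A| :> nat) /\ (L y = #|E| :> nat).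
Proof.
move=> dA dE sAE xA xE yE lt_x lt_y.
have yx : (y == x) = false by apply: contraNF yE => /eqP->.
have yA : y \in A = false by apply: contraNF yE => /(subsetP sAE).
(* Five consecutive layers: [A], then [x] alone, the rest of [E], [y] alone, and everything else.
   Any order respecting them puts exactly [A] before [x] and exactly [E] before [y]. *)
pose b u := if u \in A then 0%N else if u == x then 1%N
            else if u \in E then 2%N else if u == y then 3%N else 4%N.
have bx : b x = 1%N by rewrite /b (negbTE xA) eqxx.
have by3 : b y = 3%N by rewrite /b yA yx (negbTE yE) eqxx.
have b_le u v : (u < v)%O -> (b u <= b v)%N.
  move=> uv; rewrite /b.
  case vA: (v \in A); first by rewrite (dA u v).
  case: (v =P x) uv => [-> ux|_ uv]; first by rewrite lt_x.
  case vE: (v \in E).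
    by rewrite (dE u v) //; case: ifP => // _; case: ifP.
  case: (v =P y) uv => [-> ux|_ uv].
    by rewrite lt_y //; case: ifP => // _; case: ifP.
  by do 4?case: ifP => // _.
(* [b] is only weakly monotone, so [f] makes the weight strict inside a layer; as [f u <= #|X|], the
   factor [#|X|.+1] keeps the layers in order. *)
have [|L leL L_lt] :=
    @linear_extension_of_weight (fun u => b u * #|X|.+1 + f u)%N.
  by move=> u v uv; rewrite -addnS leq_add ?f_lt // leq_mul2r b_le ?orbT.
have Lb u v : (b u < b v)%N -> (L u < L v)%N.
  move=> buv; apply: L_lt; apply: leq_trans (leq_addr _ _).
  apply: leq_trans (leq_mul buv (leqnn #|X|.+1)).
  by rewrite mulSn addnC ltn_add2r ltnS f_le_card.
exists L => //; split; rewrite -(linear_extension_rank _ leL);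
  apply: eq_card => u; rewrite inE.
- case uA: (u \in A); first by apply: Lb; rewrite bx /b uA.
  case: (u =P x) => [->|/eqP/negbTE ux]; first exact: ltnn.
  apply/negbTE; rewrite -leqNgt; apply/ltnW/Lb.
  by rewrite bx /b uA ux; do 2?case: ifP => // _.
- case uE: (u \in E).
    by apply: Lb; rewrite by3 /b uE; do 2?case: ifP => // _.
  case: (u =P y) => [->|/eqP/negbTE uy]; first exact: ltnn.
  apply/negbTE; rewrite -leqNgt; apply/ltnW/Lb.
  have uA : u \in A = false by apply: contraFF uE => /(subsetP sAE).
  have ux : (u == x) = false by apply: contraFF uE => /eqP->.
  by rewrite by3 /b uA ux uE uy.
Qed.

(** Each bound compares disjoint sets. The elements placed before [y] and those greater than [y] all
    differ from [y]; the elements placed before [x] and those strictly between [x] and [y] are all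
    placed before [y] and differ from [x]. *)
Lemma linear_extension_bounds L x y :
  linear_extension L -> (x < y)%O ->
  [/\ (f x <= L x)%N, (L y + g y < #|X|)%N & (L x + h x y < L y)%N].
Proof.
move=> leL xy; have lt_L := linear_extension_lt leL; split.
- rewrite -(linear_extension_rank x leL); apply: subset_leq_card.
  by apply/subsetP=> u; rewrite !inE => /lt_L.
- rewrite -{1}(linear_extension_rank y leL) -cardsUI.
  set I := _ :&: _; have -> : I = set0.
    apply/setP=> u; rewrite !inE; apply/negbTE/andP => -[Luy /lt_L].
    by rewrite ltnNge (ltnW Luy).
  rewrite cards0 addn0 -[ltnRHS]cardsT; apply: proper_card.
  apply/properP; split; first exact: subsetT.
  by exists y; rewrite !inE ?ltnn ?ltxx.
- rewrite -(linear_extension_rank x leL) -(linear_extension_rank y leL) -cardsUI.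
  set I := _ :&: _; have -> : I = set0.
    apply/setP=> u; rewrite !inE; apply/negbTE/andP => -[Lux /andP[/lt_L + _]].
    by rewrite ltnNge (ltnW Lux).
  rewrite cards0 addn0; apply: proper_card; apply/properP; split.
    apply/subsetP=> u; rewrite !inE => /orP[Lux|/andP[_ /lt_L //]].
    exact: ltn_trans Lux (lt_L _ _ xy).
  by exists x; rewrite !inE ?ltnn ?ltxx ?lt_L.
Qed.

Lemma downset_pair_exists x y (k : nat) :
  (x < y)%O -> (h x y < k)%N -> (k + f x + g y < #|X|)%N ->
  exists A E, [/\ downset A, downset E & A \subset E] /\
    [/\ x \notin A, x \in E, y \notin E,
        (forall u, (u < x)%O -> u \in A) & (forall u, (u < y)%O -> u \in E)] /\
    #|E| = (#|A| + k)%N.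
Proof.
move=> xy ltk kgt.
pose Dx := [set v : X | (v < x)%O]; pose Dy := [set v : X | (v < y)%O].
pose A1 := Dy :\: [set v : X | (x <= v)%O].
pose E1 := ~: [set v : X | (y <= v)%O].
have dDx : downset Dx by move=> u v uv; rewrite !inE; apply: lt_trans.
have dDy : downset Dy by move=> u v uv; rewrite !inE; apply: lt_trans.
have dA1 : downset A1.
  move=> u v uv; rewrite !inE => /andP[xv vy]; rewrite (lt_trans uv vy) andbT.
  by apply: contraNN xv => /le_trans; apply; apply: ltW.
have dE1 : downset E1.
  move=> u v uv; rewrite !inE; apply: contraNN => /le_trans; apply; exact: ltW.
have sDxA1 : Dx \subset A1.
  apply/subsetP=> u; rewrite !inE => ux.
  by rewrite (lt_trans ux xy) andbT lt_geF.
have sA1Dy : A1 \subset Dy by apply: subsetDl.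
have sDyE1 : Dy \subset E1.
  by apply/subsetP=> u; rewrite !inE => uy; rewrite lt_geF.
(* [Dy] without [A1] is the half-open interval from [x] to [y]; the successor counts [x] itself. *)
have cDy : #|Dy| = (#|A1| + (h x y).+1)%N.
  rewrite -(cardsID [set v : X | (x <= v)%O] Dy) addnC; congr (_ + _)%N.
  rewrite (cardsD1 x) !inE xy lexx add1n; congr _.+1.
  by apply: eq_card => u; rewrite !inE [(x < u)%O]lt_def -andbA [in LHS](andbC (u < y)%O).
have cE1 : (#|E1| + (g y).+1)%N = #|X|.
  rewrite -(cardsC [set v : X | (y <= v)%O]) addnC; congr (_ + _)%N.
  rewrite (cardsD1 y) !inE lexx add1n; congr _.+1.
  by apply: eq_card => u; rewrite !inE lt_def.
(* The threshold is the difference for the intermediate pair [Dx], [Dy]. Up to it, [E] stays [Dy]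
   and [A] has size [#|Dy| - k], at most [#|A1|] because [h x y < k]. Beyond it, [A] stays [Dx] and
   [E] has size [#|Dx| + k], at most [#|E1|] by the upper bound on [k]. *)
case: (leqP k (#|Dy| - #|Dx|)) => [kle|klt].
- have [|A [dA sDA sA cA]] :=
    @downset_interpolation Dx A1 (#|Dy| - k) dDx dA1 sDxA1.
    by have := subset_leq_card sDxA1; lia.
  exists A, Dy; split; first by split=> //; apply: subset_trans sA _.
  split; last by lia.
  split; rewrite ?inE ?ltxx //.
  + by apply/negP => /(subsetP sA); rewrite !inE lexx.
  + by move=> u ux; apply: (subsetP sDA); rewrite inE.
  + by move=> u; rewrite inE.
- have cDx : #|Dx| = f x by [].
  have [|E [dE sDE sE cE]] :=
    @downset_interpolation Dy E1 (#|Dx| + k) dDy dE1 sDyE1.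
    by have := subset_leq_card sDxA1; lia.
  exists Dx, E; split.
    by split=> //; apply: subset_trans sDE; apply: subset_trans sA1Dy.
  split; last by lia.
  split; rewrite ?inE ?ltxx //.
  + by apply: (subsetP sDE); rewrite inE.
  + by apply/negP => /(subsetP sE); rewrite !inE lexx.
  + by move=> u; rewrite inE.
  + by move=> u uy; apply: (subsetP sDE); rewrite inE.
Qed.

End Realization.

Theorem theorem8p5 (d : Order.disp_t) (X : finPOrderType d) (x y : X)
    (hxy : (x < y)%O) (k : int) :
  (0 < F x y k)%N <->
  ((h x y)%:Z < k < #|X|%:Z - (f x)%:Z - (g y)%:Z)%R.
Proof.
rewrite /F; split.
  case/card_gt0P=> L; rewrite inE => /andP[leL /eqP <-].
  have [] := linear_extension_bounds leL hxy; rewrite /label; lia.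
move=> /andP[hk kn]; apply/card_gt0P.
(* The lower bound [h x y < k] forces [k] to be positive. *)
have [m km] : exists m : nat, k = Posz m by exists `|k|%N; lia.
have [||A [E [[dA dE sAE] [[xA xE yE lx ly] cE]]]] :=
  @downset_pair_exists _ _ x y m hxy; [lia|lia|].
have [L leL [Lx Ly]] :=
  @linear_extension_of_downsets _ _ x y _ _ dA dE sAE xA xE yE lx ly.
by exists L; rewrite inE leL /label Lx Ly cE km; lia.
Qed.
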